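(* Let $T$ be a tree on $n$ vertices. Then $I_s(T) \geq \frac{5n+3}{13}$.
   Context: The competition-independence game on a graph $G$ is played by two players, Sweller and Diminisher, who alternately choose a vertex of $G$ not adjacent to (and distinct from) any previously chosen vertex, until no such vertex exists; the chosen set is then a maximal independent set of $G$. Sweller wants the final set to be as large as possible, Diminisher as small as possible. $I_s(G)$ denotes the size of the final set (equivalently, the number of moves) when Sweller moves first and both players play optimally. *)

(* Defs.v *)
From mathcomp Require Import all_boot all_order all_algebra.

Set Implicit Arguments.
Unset Strict Implicit.
Unset Printing Implicit Defensive.

Record sgraph := SGraph {
  vertex :> finType;
  edge : rel vertex;
  edge_sym : symmetric edge;
  edge_irrefl : irreflexive edge }.

Definition connected_graph (G : sgraph) : Prop :=
  0 < #|G| /\ forall x y : G, connect (@edge G) x y.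

(* In a simple graph a duplicate-free closed walk [:: x; y] only retraces the
   edge xy; genuine cycles have at least three vertices. *)
Definition acyclic (G : sgraph) : Prop :=
  forall c : seq G, ucycle (@edge G) c -> size c < 3.

Definition is_tree (G : sgraph) : Prop := connected_graph G /\ acyclic G.

Inductive player := Sweller | Diminisher.

Definition opponent (p : player) : player :=
  if p is Sweller then Diminisher else Sweller.

Section Game.

Variable G : sgraph.
Implicit Types (A : {set G}) (p : player).

Definition legal_moves A : {set G} :=
  [set v | (v \notin A) && [forall u in A, ~~ edge u v]].

(* [best p A F] is the value that p selects among F v, for v legal after A.
   The default #|G| of the minimum bounds the size of every set of vertices,
   so it is neutral as soon as a legal move exists: see [best_attained]. *)
Definition best p A (F : G -> nat) : nat :=
  match p with
  | Sweller => \max_(v in legal_moves A) F v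
  | Diminisher => \big[minn/#|G|]_(v in legal_moves A) F v
  end.

Fixpoint final_size_rec (k : nat) p A : nat :=
  if k is k'.+1 then
    if legal_moves A == set0 then #|A|
    else best p A (fun v => final_size_rec k' (opponent p) (v |: A))
  else #|A|.

(* Size of the final set under optimal play when the vertices of A have been
   chosen and p is to move. The bound #|~: A| on the number of remaining moves
   is never restrictive: see [final_sizeE]. *)
Definition final_size p A : nat := final_size_rec #|~: A| p A.

Lemma final_sizeE p A :
  final_size p A =
    if legal_moves A == set0 then #|A|
    else best p A (fun v => final_size (opponent p) (v |: A)).
Proof.
rewrite /final_size; case Dk: #|~: A| => [|k] /=.
  case: eqP => // /eqP/set0Pn[v]; rewrite inE => /andP[vA _].
  by move/eqP: Dk; rewrite cards_eq0 => /eqP/setP/(_ v); rewrite !inE vA.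
have E v : v \in legal_moves A -> #|~: (v |: A)| = k.
  rewrite inE => /andP[vA _]; have := cardsC A; have := cardsC (v |: A).
  rewrite cardsU1 vA Dk add1n addSnnS => <- /eqP.
  by rewrite eqn_add2l eqSS => /eqP.
case: ifP => // _; case: p => /=; apply: eq_bigr => v /E -> //.
Qed.

Lemma best_attained p A (F : G -> nat) :
  legal_moves A != set0 -> (forall v, F v <= #|G|) ->
  exists2 v, v \in legal_moves A & best p A F = F v.
Proof.
move=> /set0Pn[v0 v0A] FG; case: p => /=.
  have [|v vA ->] := eq_bigmax_cond F (A := mem (legal_moves A)).
    by apply/card_gt0P; exists v0.
  by exists v.
have [v vL vmin] := arg_minnP F v0A; have vA : v \in legal_moves A := vL.
exists v => //; clear vL.
apply/eqP; rewrite eqn_leq; apply/andP; split.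
  have : v \in index_enum G by rewrite mem_index_enum.
  elim: (index_enum G) => //= u r IHr; rewrite inE big_cons => /predU1P[<-|vr].
    by rewrite vA geq_minl.
  by case: ifP => _; rewrite ?geq_min IHr ?orbT.
by elim/big_ind: _ => // x y hx hy; rewrite leq_min hx.
Qed.

Lemma final_size_le p A : final_size p A <= #|G|.
Proof.
rewrite /final_size; move: #|~: A| => k.
elim: k p A => [|k IHk] p A /=; first exact: max_card.
case: ifPn => [_|hA]; first exact: max_card.
have [|v _ ->] := best_attained p (F := fun v =>
  final_size_rec k (opponent p) (v |: A)) hA; last exact: IHk.
by move=> v; apply: IHk.
Qed.

End Game.

Definition I_s (G : sgraph) : nat := final_size Sweller (set0 : {set G}).

(* Main.v *)
(** Give a forest with n vertices, e edges and i isolated vertices the potential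
    8n - 3e + 5i. For a tree it is at least 5n + 3, so it suffices that Sweller
    can always make a move such that it, followed by any reply of Diminisher,
    lowers the potential of the set of still playable vertices by at most 26,
    and by at most 13 if the game ends at once.

    Since a forest has no cycles of length 3 or 4, the loss caused by a move at
    a nonisolated vertex w is a sum over the neighbours x of w of contributions
    depending on the degree of x and the number of leaves attached to x. As there
    are no cycles of length 5 or 6 either, Sweller's move at s raises the cost of
    a move at w by at most 3, unless w is at distance two from s, where w loses
    the contribution of one neighbour. Let w be a move of maximal cost M. If
    M <= 13, Sweller plays any vertex of degree at most one. Otherwise Sweller
    spoils the threat at w: she plays a neighbour of w of degree two whose other
    neighbour is not a leaf if there is one, and else a leaf attached to w. *)
Require Import Defs.
From mathcomp Require Import all_boot all_order all_algebra.
From mathcomp Require Import zify.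
Import Order.TTheory GRing.Theory Num.Theory.
Local Open Scope ring_scope.

Section Forest.

Set Implicit Arguments.
Unset Strict Implicit.
Unset Printing Implicit Defensive.

Variable G : sgraph.
Hypothesis acyclicG : acyclic G.
Implicit Types (S A : {set G}) (u v w x y z s b : G).

(** * Exclusion of short cycles *)

Lemma edgeC u v : edge u v = edge v u. Proof. exact: edge_sym. Qed.

Lemma edge_neq u v : edge u v -> u != v.
Proof. by apply: contraTneq => ->; rewrite edge_irrefl. Qed.

Lemma no_cycle3 u v w : edge u v -> edge v w -> edge w u -> False.
Proof.
move=> uv vw wu; have := @acyclicG [:: u; v; w].
rewrite /ucycle /= uv vw wu !inE (negPf (edge_neq uv)) (negPf (edge_neq vw)).
by rewrite eq_sym (negPf (edge_neq wu)) => /(_ isT).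
Qed.

Lemma no_cycle4 u v w x :
  edge u v -> edge v w -> edge w x -> edge x u -> u != w -> v != x -> False.
Proof.
move=> uv vw wx xu uw vx; have := @acyclicG [:: u; v; w; x].
rewrite /ucycle /= uv vw wx xu !inE (negPf uw) (negPf vx).
rewrite (negPf (edge_neq uv)) (negPf (edge_neq vw)) (negPf (edge_neq wx)).
by rewrite eq_sym (negPf (edge_neq xu)) => /(_ isT).
Qed.

(** If two vertices two steps apart coincide, the other three edges form a triangle; otherwise the
    walk is a genuine cycle. *)
Lemma no_cycle5 u v w x y :
  edge u v -> edge v w -> edge w x -> edge x y -> edge y u -> False.
Proof.
move=> uv vw wx xy yu; have := @acyclicG [:: u; v; w; x; y].
have D a b c d e : edge a b -> edge b c -> edge c d -> edge d e ->
    edge e a -> (a == c) = false.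
  move=> ab bc cd de ea; apply/eqP => ac; rewrite -ac in cd.
  exact: no_cycle3 cd de ea.
rewrite /ucycle /= uv vw wx xy yu !inE.
rewrite (D _ _ _ _ _ uv vw wx xy yu) (D _ _ _ _ _ vw wx xy yu uv).
rewrite (D _ _ _ _ _ wx xy yu uv vw) (eq_sym u x) (D _ _ _ _ _ xy yu uv vw wx).
rewrite (eq_sym v y) (D _ _ _ _ _ yu uv vw wx xy) (eq_sym u y).
rewrite (negPf (edge_neq uv)) (negPf (edge_neq vw)) (negPf (edge_neq wx)).
by rewrite (negPf (edge_neq xy)) (negPf (edge_neq yu)) => /(_ isT).
Qed.

Lemma no_cycle6 u v w x y z :
  edge u v -> edge v w -> edge w x -> edge x y -> edge y z -> edge z u ->
  uniq [:: u; w; y] -> uniq [:: v; x; z] -> False.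
Proof.
move=> uv vw wx xy yz zu; rewrite /= !inE !negb_or !andbT.
move=> /andP[/andP[uw uy] wy] /andP[/andP[vx vz] xz].
have N5 a b c d e f : edge a b -> edge b c -> edge c d -> edge d e ->
    edge e f -> edge f a -> b != f -> (a == d) = false.
  move=> ab bc cd de ef fa bf; apply/eqP => ad; rewrite -ad in cd.
  exact: no_cycle3 ab bc cd.
have := @acyclicG [:: u; v; w; x; y; z].
rewrite /ucycle /= uv vw wx xy yz zu !inE.
rewrite (negPf uw) (negPf uy) (negPf wy) (negPf vx) (negPf vz) (negPf xz).
rewrite (N5 _ _ _ _ _ _ uv vw wx xy yz zu) //.
rewrite (N5 _ _ _ _ _ _ vw wx xy yz zu uv) 1?eq_sym //.
rewrite (N5 _ _ _ _ _ _ wx xy yz zu uv vw) 1?eq_sym //.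
rewrite (negPf (edge_neq uv)) (negPf (edge_neq vw)) (negPf (edge_neq wx)).
rewrite (negPf (edge_neq xy)) (negPf (edge_neq yz)) (eq_sym u z).
by rewrite (negPf (edge_neq zu)) => /(_ isT).
Qed.

(** * Degrees in induced subforests *)

Definition nbrs S v : {set G} := [set u in S | edge v u].
Definition leaves S v : {set G} := [set u in nbrs S v | #|nbrs S u| == 1%N].
Definition remainder S v : {set G} := S :\: (v |: nbrs S v).

Lemma in_nbrs S u v : (u \in nbrs S v) = (u \in S) && edge v u.
Proof. by rewrite inE. Qed.

Lemma in_remainder S u v :
  (u \in remainder S v) = [&& u \in S, u != v & ~~ edge v u].
Proof. by rewrite !inE negb_or; case: (u \in S); rewrite ?andbF ?andbT. Qed.

(** If all degrees were at least two, a path could be prolonged at its head forever: a further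
    neighbour of the head lying on the path would close a cycle. *)
Lemma small_degree S : S != set0 -> exists2 v, v \in S & (#|nbrs S v| <= 1)%N.
Proof.
case/set0Pn=> v0 v0S.
have [/existsP[v /andP[vS dv]]|/existsPn H] :=
  boolP [exists v, (v \in S) && (#|nbrs S v| <= 1)%N]; first by exists v.
have deg2 v : v \in S -> (1 < #|nbrs S v|)%N.
  by move=> vS; have := H v; rewrite vS /= -ltnNge.
suff long k : exists x p,
    [/\ path (@edge G) x p, uniq (x :: p), x \in S & size p = k].
  have [x [p [_ Up _ sp]]] := long #|G|.
  by have := uniq_leq_size Up (fun y _ => mem_enum G y); rewrite -cardE /= sp ltnn.
elim: k => [|k [x [p [pp Up xS sp]]]]; first by exists v0, [::].
(* [head x p] is the second vertex of the path; for empty [p] it is [x], which is no neighbour of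
   itself. *)
have [z zN zh] : exists2 z, z \in nbrs S x & z != head x p.
  have /card_gt0P[z] : (0 < #|nbrs S x :\ head x p|)%N.
    by have := deg2 _ xS; rewrite (cardsD1 (head x p)); case: (_ \in _); lia.
  by rewrite !inE -in_nbrs => /andP[zh zN]; exists z.
have [zS xz] : z \in S /\ edge x z by move: zN; rewrite in_nbrs => /andP.
have [zp|zp] := boolP (z \in p); last first.
  exists z, (x :: p); split => //=; first by rewrite edgeC xz.
    by rewrite inE eq_sym (negPf (edge_neq xz)) zp.
  by rewrite sp.
case/splitPr: zp pp Up zh {sp} => p1 p2.
rewrite cat_path /= => /and3P[pp1 lz _] Up zh.
have {Up} Up : uniq (x :: rcons p1 z).
  by move: Up; rewrite -cat_rcons -[_ && _]/(uniq ((_ :: _) ++ _)) cat_uniq => /andP[].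
have := @acyclicG (x :: rcons p1 z); rewrite /ucycle Up /=.
rewrite !rcons_path last_rcons pp1 lz (edgeC z) xz size_rcons.
by case: p1 {pp1 lz Up} zh => [|a p1]; [rewrite /= eqxx | move=> _ /(_ isT)].
Qed.

(** Removing a vertex of degree at most one lowers the degree sum by at most 2; the last vertex has
    degree 0. *)
Lemma sum_degree S : S != set0 ->
  (\sum_(v in S) #|nbrs S v| + 2 <= 2 * #|S|)%N.
Proof.
move: {2}#|S| (leqnn #|S|) => n; elim: n S => [|n IHn] S.
  by rewrite leqn0 cards_eq0 => ->.
move=> Sn S0; have [v vS dv] := small_degree S0.
have SD : #|S| = #|S :\ v|.+1 by rewrite (cardsD1 v) vS.
have [E|N0] := eqVneq (S :\ v) set0.
  have -> : S = [set v] by rewrite -(setD1K vS) E setU0.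
  rewrite big_set1 cards1 (_ : nbrs _ _ = set0) ?cards0 //.
  apply/setP=> u; rewrite !inE; apply/andP=> -[/eqP->].
  by rewrite edge_irrefl.
have := IHn (S :\ v); rewrite SD in Sn; move/(_ Sn N0) => IH.
have E : \sum_(u in S :\ v) #|nbrs S u| =
    (\sum_(u in S :\ v) #|nbrs (S :\ v) u| + #|nbrs S v|)%N.
  have -> : #|nbrs S v| = (\sum_(u in S :\ v) (edge u v : nat))%N.
    rewrite -big_mkcondr -sum1_card /=; apply: eq_bigl => u.
    rewrite !inE (edgeC u); case: eqP => [->|_]; last by [].
    by rewrite edge_irrefl andbF.
  rewrite -big_split /=; apply: eq_bigr => u _.
  rewrite (cardsD1 v (nbrs S u)) in_nbrs vS /= addnC; congr (_ + _)%N.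
  by apply: eq_card => z; rewrite !inE; rewrite andbA.
rewrite (big_setD1 v vS) /= E SD; lia.
Qed.

(** * The potential and its loss in one move *)

Lemma nbrs_remainder S s u :
  u \in remainder S s -> nbrs (remainder S s) u = nbrs S u :\: nbrs S s.
Proof.
rewrite in_remainder => /and3P[uS us su]; apply/setP=> z.
rewrite !inE; have [->|zs] := eqVneq z s; first by rewrite edgeC (negPf su) !andbF.
by rewrite /= -andbA.
Qed.

Lemma common_nbr S u v : u != v -> (#|nbrs S u :&: nbrs S v| <= 1)%N.
Proof.
move=> uv; rewrite leqNgt; apply/negP=> /card_gt1P[x [y []]].
rewrite !inE => /andP[/andP[_ ux] /andP[_ vx]] /andP[/andP[_ uy] /andP[_ vy]] xy.
by apply: (@no_cycle4 u x v y) => //; rewrite edgeC.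
Qed.

Lemma card_nbrs_remainder S s u : u \in remainder S s ->
  (#|nbrs (remainder S s) u| + #|nbrs S u :&: nbrs S s| = #|nbrs S u|)%N.
Proof. by move=> uR; rewrite nbrs_remainder // addnC cardsID. Qed.

(* The sum of these weights is twice 8n - 3e + 5i, by the handshake lemma. *)
Definition weight (d : nat) : int := 16 - 3 * d%:Z + (if d == 0 then 10 else 0).

Definition potential S : int := \sum_(v in S) weight #|nbrs S v|.

(* In units of 8n - 3e + 5i, see [potential_remainder]: x takes away one vertex
   and its edges, and isolates the leaves attached to it. *)
Definition nbr_cost S w x : int :=
  8 - 3 * #|nbrs S x|%:Z - 5 * #|leaves S x :\ w|%:Z.

(** An isolated vertex takes away its 8 and its bonus 5. Otherwise 8 stands for [w] itself; the
    edges at [w] are charged to its neighbours. *)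
Definition move_cost S w : int :=
  if nbrs S w == set0 then 13 else 8 + \sum_(x in nbrs S w) nbr_cost S w x.

Lemma potential_remainder S w : w \in S ->
  potential S <= 2 * move_cost S w + potential (remainder S w).
Proof.
move=> wS; rewrite /move_cost.
have PS : potential S = weight #|nbrs S w| +
    \sum_(x in nbrs S w) weight #|nbrs S x| +
    \sum_(u in remainder S w) weight #|nbrs S u|.
  rewrite /potential (bigID (mem (remainder S w))) /= addrC; congr (_ + _).
    rewrite (bigD1 w) /=; last by rewrite in_remainder eqxx wS.
    congr (_ + _); apply: eq_bigl => u; rewrite in_remainder in_nbrs.
    case: (u \in S); rewrite //= negb_and !negbK.
    case: eqP => [->|_] /=; last by rewrite andbT.
    by rewrite edge_irrefl.
  apply: eq_bigl => u; rewrite in_remainder.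
  by case: (u \in S); rewrite // andbF.
(* A surviving [u] loses at most one edge, as it shares at most one neighbour with [w]. The loss
   raises its weight by 3, and by 10 more if [u] becomes isolated. *)
have wt u : u \in remainder S w -> weight #|nbrs S u| <=
   weight #|nbrs (remainder S w) u| +
   \sum_(x in nbrs S w) (if edge x u then
       (- 3 - (if #|nbrs S u| == 1%N then 10 else 0)) else 0).
  move=> uR; have := card_nbrs_remainder uR.
  have uw : u != w by move: uR; rewrite in_remainder => /and3P[].
  have uS : u \in S by move: uR; rewrite in_remainder => /and3P[].
  rewrite -big_mkcondr (eq_bigl (mem (nbrs S u :&: nbrs S w))); last first.
    by move=> x; rewrite !inE (edgeC u); case: (x \in S); rewrite //= andbC.
  rewrite sumr_const; have := common_nbr S uw.
  case: #|_ :&: _| => [|[|//]] _ <-; rewrite /weight ?mulr0n ?mulr1n.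
    by rewrite addn0 addr0.
  by case: #|nbrs (remainder S w) u| => [|k]; rewrite addn1 /=; lia.
rewrite PS; case: eqP => [N0|/eqP N0].
  have : \sum_(u in remainder S w) weight #|nbrs S u| <= potential (remainder S w).
    by apply: ler_sum => u /wt; rewrite N0 big_set0 addr0.
  by rewrite N0 !big_set0 cards0 /weight /=; lia.
have := ler_sum (index_enum G) wt.
rewrite [leRHS]big_split /= [X in _ <= _ + X]exchange_big /= => wts.
(* After exchanging the sums, each neighbour of [w] collects the changes at its own other
   neighbours. The surplus 3 per neighbour cancels the degree term in the weight of [w]. *)
have cx x : x \in nbrs S w ->
  weight #|nbrs S x| + (\sum_(u in remainder S w) if edge x u then
       (- 3 - (if #|nbrs S u| == 1%N then 10 else 0)) else 0)
  = 2 * nbr_cost S w x + 3.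
  move=> xN; have [xS wx] : x \in S /\ edge w x by apply/andP; rewrite -in_nbrs.
  have wN : w \in nbrs S x by rewrite in_nbrs wS edgeC.
  rewrite -big_mkcondr (eq_bigl (fun u => u \in nbrs S x :\ w)); last first.
    move=> u; rewrite in_remainder !inE.
    case uS: (u \in S); rewrite ?andbF //=.
    case xu: (edge x u); rewrite ?andbF // !andbT.
    case wu: (edge w u); rewrite ?andbF ?andbT //.
    by case: (no_cycle3 wx xu); rewrite edgeC.
  rewrite big_split /= sumr_const sumrN -big_mkcondr /=.
  rewrite (eq_bigl (fun u => u \in leaves S x :\ w)); last first.
    by move=> u; rewrite !inE /= -!andbA.
  rewrite sumr_const /nbr_cost /weight (cardsD1 w (nbrs S x)) wN add1n /=.
  by lia.
have cxs : \sum_(x in nbrs S w) weight #|nbrs S x| +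
    \sum_(x in nbrs S w) \sum_(u in remainder S w)
      (if edge x u then - 3 - (if #|nbrs S u| == 1%N then 10 else 0) else 0) =
    2 * \sum_(x in nbrs S w) nbr_cost S w x + 3 *+ #|nbrs S w|.
  by rewrite -big_split /= (eq_bigr _ cx) big_split /= -mulr_sumr sumr_const.
have Nw : (0 < #|nbrs S w|)%N by rewrite card_gt0.
have -> : weight #|nbrs S w| = 16 - 3 * #|nbrs S w|%:Z.
  by rewrite /weight; case: #|_| Nw => //= k _; rewrite addr0.
have arith (d : nat) (A X C B P : int) :
  A + X = 2 * C + 3 *+ d -> B <= P + X -> 16 - 3 * d%:Z + A + B <= 2 * (8 + C) + P.
  by lia.
exact: arith cxs wts.
Qed.

(** * Effect of Sweller's move on the cost of a reply *)

(** Each common neighbour of [x] and [s] takes 1 off the degree of [x]. Leaves at [x] are neither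
    [s] nor adjacent to [s], so they survive as leaves. *)
Lemma nbr_cost_remainder S s w x : s \in S -> x \in remainder S s ->
  nbr_cost (remainder S s) w x <=
    nbr_cost S w x + 3 * #|nbrs S x :&: nbrs S s|%:Z.
Proof.
move=> sS xR; have [xS xs nsx] : [/\ x \in S, x != s & ~~ edge s x].
  by move: xR; rewrite in_remainder => /and3P[].
have sub : leaves S x :\ w \subset leaves (remainder S s) x :\ w.
  apply/subsetP=> z; rewrite !in_setD1 => /andP[-> /=].
  rewrite inE in_nbrs => /andP[/andP[zS xz] /cards1P[x' Nz]].
  have xz' : x' = x.
    by apply/esym/set1P; rewrite -Nz in_nbrs xS edgeC.
  have zR : z \in remainder S s.
    rewrite in_remainder zS /=; apply/andP; split.
      by apply: contraNneq nsx => <-; rewrite edgeC.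
    apply: contra xs => sz; rewrite eq_sym -in_set1 -xz' -Nz in_nbrs sS.
    by rewrite edgeC.
  rewrite inE in_nbrs zR xz nbrs_remainder // Nz xz' -[X in _ == X](cards1 x).
  apply/eqP; congr #|pred_of_set _|; apply/setP=> u; rewrite in_setD in_set1 in_nbrs.
  by have [->|] := eqVneq u x; rewrite ?andbF // (negPf nsx) andbF.
have := subset_leq_card sub; have := card_nbrs_remainder xR.
rewrite /nbr_cost; lia.
Qed.

(* The cases are: w becomes isolated, or is at distance at least four, exactly
   three, or exactly two from s. *)
Lemma response_cost S s w : s \in S -> w \in remainder S s ->
  [\/ move_cost (remainder S s) w = 13,
      move_cost (remainder S s) w <= move_cost S w,
      exists2 b, b \in nbrs S s & (1 < #|nbrs S b|)%N /\
        move_cost (remainder S s) w <= move_cost S w + 3 |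
      exists2 b, b \in nbrs S s & edge b w /\
        move_cost (remainder S s) w <= move_cost S w - nbr_cost S w b].
Proof.
move=> sS wR; rewrite /move_cost; case: eqP => [|/eqP R0]; first by constructor 1.
have [wS ws nsw] : [/\ w \in S, w != s & ~~ edge s w].
  by move: wR; rewrite in_remainder => /and3P[].
have NR := nbrs_remainder wR.
have xRP x : x \in nbrs S w -> x \notin nbrs S s -> x \in remainder S s.
  rewrite !in_nbrs in_remainder => /andP[xS wx]; rewrite xS /= => ->.
  by rewrite andbT; apply: contraNneq nsw => <-; rewrite edgeC.
case: eqP => [N0|_]; first by rewrite NR N0 set0D eqxx in R0.
have [I0|] := eqVneq (nbrs S w :&: nbrs S s) set0; last first.
  case/set0Pn=> b; rewrite inE => /andP[bw bs]; constructor 4.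
  exists b => //; split; first by move: bw; rewrite in_nbrs edgeC => /andP[].
  have E : nbrs (remainder S s) w = nbrs S w :\ b.
    rewrite NR; apply/setP=> x; rewrite !(in_setD, in_set1).
    have [xw|] := boolP (x \in nbrs S w); rewrite ?andbF // !andbT.
    have [->|xb] := eqVneq x b; first by rewrite bs.
    apply/negP=> xs; have := common_nbr S ws; rewrite leqNgt; case/negP.
    by apply/card_gt1P; exists x, b; rewrite !in_setI xw xs bw bs.
  rewrite (big_setD1 b bw) /= E.
  have : \sum_(x in nbrs S w :\ b) nbr_cost (remainder S s) w x <=
         \sum_(x in nbrs S w :\ b) nbr_cost S w x.
    apply: ler_sum => x; rewrite -E NR in_setD => /andP[xs xw].
    have := nbr_cost_remainder w sS (xRP _ xw xs).
    rewrite (_ : _ :&: _ = set0) ?cards0 ?mulr0 ?addr0 //.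
    (* Such a [c] would close the 5-cycle [w], [x], [c], [s], [b]. *)
    apply/setP=> c; rewrite !inE; apply/negP.
    move=> /andP[/andP[_ xc] /andP[_ sc]].
    move: xw bw bs; rewrite !in_nbrs => /andP[_ wx] /andP[_ wb] /andP[_ sb].
    by apply: (no_cycle5 wx xc _ sb _); rewrite edgeC.
  have arith (p q r : int) : p <= r -> 8 + p <= 8 + (q + r) - q.
    by clear; lia.
  exact: arith.
have E : nbrs (remainder S s) w = nbrs S w.
  by rewrite NR; apply/setDidPl; rewrite -setI_eq0 I0.
have xR x : x \in nbrs S w -> x \in remainder S s.
  move=> xw; apply: (xRP _ xw); apply/negP=> xs.
  by have := in_set0 x; rewrite -I0 in_setI xw xs.
rewrite E; have le_c x : x \in nbrs S w -> _ :=
  fun xw => nbr_cost_remainder w sS (xR x xw).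
have [/existsP[x0 /andP[x0w /set0Pn[b]]]|/existsPn none] :=
  boolP [exists x, (x \in nbrs S w) && (nbrs S x :&: nbrs S s != set0)].
  rewrite inE => /andP[bx0 bs]; constructor 3; exists b => //.
  have [x0S wx0] : x0 \in S /\ edge w x0 by apply/andP; rewrite -in_nbrs.
  have [bS sb] : b \in S /\ edge s b by apply/andP; rewrite -in_nbrs.
  have x0b : edge x0 b by move: bx0; rewrite in_nbrs => /andP[].
  have x0s : x0 != s by have := xR x0 x0w; rewrite in_remainder => /and3P[].
  split.
    apply/card_gt1P; exists x0, s; split=> //; rewrite in_nbrs.
      by rewrite x0S edgeC.
    by rewrite sS edgeC.
  rewrite !(big_setD1 x0 x0w) /=.
  have := le_c x0 x0w; have := common_nbr S x0s.
  (* Only [x0] can share a neighbour with [s]: a second such [x] would give a cycle of length 4 or 6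
     through [w]. *)
  have : \sum_(x in nbrs S w :\ x0) nbr_cost (remainder S s) w x <=
         \sum_(x in nbrs S w :\ x0) nbr_cost S w x.
    apply: ler_sum => x; rewrite in_setD1 => /andP[xx0 xw].
    have := le_c x xw.
    rewrite (_ : _ :&: _ = set0) ?cards0 ?mulr0 ?addr0 //.
    apply/setP=> c; rewrite !inE; apply/negP.
    move=> /andP[/andP[_ xc] /andP[_ sc]].
    have xs : x != s by have := xR x xw; rewrite in_remainder => /and3P[].
    have wx : edge w x by move: xw; rewrite in_nbrs => /andP[].
    have ncw : c != w by apply: contraNneq nsw => <-.
    have nbw : b != w by apply: contraNneq nsw => <-.
    have [bc|bc] := eqVneq b c.
      subst c; apply: (@no_cycle4 w x b x0) => //; rewrite 1?edgeC //.
      by rewrite eq_sym.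
    apply: (@no_cycle6 w x c s b x0); rewrite // 1?edgeC // /= !inE ?negb_or.
      by rewrite !(eq_sym w) ncw nbw eq_sym bc.
    by rewrite xs xx0 eq_sym x0s.
  have arith (p q r t : int) (k : nat) :
      r <= t -> (k <= 1)%N -> p <= q + 3 * k%:Z -> 8 + (p + r) <= 8 + (q + t) + 3.
    by clear; lia.
  exact: arith.
constructor 2; rewrite lerD2l; apply: ler_sum => x xw.
have := le_c x xw; rewrite (_ : _ :&: _ = set0) ?cards0 ?mulr0 ?addr0 //.
by apply/eqP; have := none x; rewrite xw /= negbK.
Qed.

(** * Upper bounds for the cost of a move *)

Lemma sum_nbrs_le S w (F : G -> int) (a b : int) :
  (forall x, x \in nbrs S w -> F x <= a + (if x \in leaves S w then b else 0)) ->
  \sum_(x in nbrs S w) F x <= a *+ #|nbrs S w| + b *+ #|leaves S w|.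
Proof.
move=> le_F; apply: (le_trans (ler_sum _ le_F)).
rewrite big_split /= sumr_const -big_mkcondr /= lerD2l.
rewrite (eq_bigl (fun x => x \in leaves S w)) ?sumr_const // => x.
by rewrite [x \in leaves S w]inE andbA andbb.
Qed.

Lemma leavesP S w x :
  reflect (x \in nbrs S w /\ #|nbrs S x| = 1%N) (x \in leaves S w).
Proof. by rewrite /leaves in_set; apply: (iffP andP) => -[xw /eqP]. Qed.

Lemma nbrs_sym S v w : v \in S -> w \in nbrs S v -> v \in nbrs S w.
Proof. by rewrite !in_nbrs edgeC => -> /andP[_ ->]. Qed.

Lemma nbrs_gt0 S v w : v \in S -> w \in nbrs S v -> (0 < #|nbrs S w|)%N.
Proof. by move=> vS wv; apply/card_gt0P; exists v; apply: nbrs_sym. Qed.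

Lemma nbr_cost_le S w x : w \in S -> x \in nbrs S w ->
  nbr_cost S w x <= 2 + (if x \in leaves S w then 3 else 0).
Proof.
move=> wS xw; have := nbrs_gt0 wS xw; rewrite inE xw /= /nbr_cost.
by case: eqP; lia.
Qed.

Lemma move_costE S w v : v \in nbrs S w ->
  move_cost S w = 8 + \sum_(x in nbrs S w) nbr_cost S w x.
Proof. by move=> vw; rewrite /move_cost; case: eqP vw => // ->; rewrite in_set0. Qed.

Lemma move_cost_le S w : w \in S -> (2 <= #|nbrs S w|)%N ->
  move_cost S w <= 8 + 2 * #|nbrs S w|%:Z + 3 * #|leaves S w|%:Z.
Proof.
move=> wS dw; have /card_gt0P[v vw] := ltnW dw.
rewrite (move_costE vw).
have := sum_nbrs_le (fun x => @nbr_cost_le S w x wS).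
lia.
Qed.

(** A nonleaf neighbour contributes at most -1: it has degree at least three, or degree two and a
    leaf besides [w]. A leaf contributes 5. *)
Lemma move_cost_le_rigid S w : w \in S -> (2 <= #|nbrs S w|)%N ->
  (forall x, x \in nbrs S w -> #|nbrs S x| = 2 -> leaves S x :\ w != set0) ->
  move_cost S w <= 8 - #|nbrs S w|%:Z + 6 * #|leaves S w|%:Z.
Proof.
move=> wS dw rigid; have /card_gt0P[v vw] := ltnW dw.
rewrite (move_costE vw).
have le6 x : x \in nbrs S w ->
    nbr_cost S w x <= -1 + (if x \in leaves S w then 6 else 0).
  move=> xw; have := nbrs_gt0 wS xw; have := rigid x xw.
  rewrite -card_gt0 inE xw /= /nbr_cost.
  by case: #|nbrs S x| => [|[|[|k]]] //= deg2 _; lia.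
have := sum_nbrs_le le6; lia.
Qed.

Lemma move_cost_le_adj S w v : w \in S -> v \in nbrs S w -> v \notin leaves S w ->
  move_cost S w <=
    6 + 2 * #|nbrs S w|%:Z + 3 * #|leaves S w|%:Z + nbr_cost S w v.
Proof.
move=> wS vw vl; rewrite (move_costE vw).
(* Replacing the contribution of [v] by its upper bound 2 keeps the true one free for the
   conclusion. *)
have le_F x : x \in nbrs S w -> (if x == v then 2 else nbr_cost S w x) <=
    2 + (if x \in leaves S w then 3 else 0).
  by move=> xw; case: eqP => [->|_]; [rewrite (negPf vl) | apply: nbr_cost_le].
have := sum_nbrs_le le_F.
rewrite !(big_setD1 v vw) /= eqxx.
rewrite (eq_bigr (nbr_cost S w)); last first.
  by move=> x; rewrite in_setD1 => /andP[/negPf->].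
have arith (p q : int) (d l : nat) : 2 + p <= 2 *+ d + 3 *+ l ->
  8 + (q + p) <= 6 + 2 * d%:Z + 3 * l%:Z + q by lia.
exact: arith.
Qed.

Lemma nbr_cost_back S w x : (2 <= #|nbrs S w|)%N ->
  nbr_cost S w x = 8 - 3 * #|nbrs S x|%:Z - 5 * #|leaves S x|%:Z.
Proof.
move=> dw; rewrite /nbr_cost (cardsD1 w (leaves S x)).
suff /negPf-> : w \notin leaves S x by [].
by apply/leavesP=> -[_ d1]; rewrite d1 in dw.
Qed.

Lemma move_cost_leaf S v w : nbrs S v = [set w] ->
  move_cost S v = 8 + nbr_cost S v w.
Proof.
by move=> Nv; rewrite (@move_costE S v w) Nv ?big_set1 // in_set1.
Qed.

(* If both ends have degree at least two, the costs of the two moves add up to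
   at most 24, since each end pays for the degree of the other. *)
Lemma move_cost_adj_le S w v : w \in S -> v \in nbrs S w ->
  (2 <= #|nbrs S w|)%N -> move_cost S v <= move_cost S w -> move_cost S v <= 13.
Proof.
move=> wS vw dw vlew.
have vS : v \in S by move: vw; rewrite in_nbrs => /andP[].
have wv := nbrs_sym wS vw.
have [dv|dv] := leqP 2 #|nbrs S v|.
  have vl : v \notin leaves S w by apply/leavesP=> -[_ d1]; rewrite d1 in dv.
  have wl : w \notin leaves S v by apply/leavesP=> -[_ d1]; rewrite d1 in dw.
  have := move_cost_le_adj wS vw vl; have := move_cost_le_adj vS wv wl.
  by rewrite !nbr_cost_back //; lia.
have /cards1P[w' Nv] : #|nbrs S v| == 1%N.
  by have := nbrs_gt0 wS vw; case: #|_| dv => [|[]].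
move: (wv); rewrite Nv in_set1 => /eqP ww'; rewrite -ww' in Nv.
by rewrite (move_cost_leaf Nv) /nbr_cost; lia.
Qed.

(** * Good moves for Sweller *)

Definition good_move S s :=
  move_cost S s <= 13 /\ forall u, u \in remainder S s ->
    move_cost S s + move_cost (remainder S s) u <= 26.

(** The leaf [v] costs 21 - 3d - 5l, where [w] has degree d and l leaves. This leaves 5 + 3d + 5l
    for the reply, hence the bound in [le_all] after a rise by 3. A reply adjacent to [w] loses the
    contribution of [w], so 13 suffices there. *)
Lemma good_leaf S v w : v \in S -> nbrs S v = [set w] -> (2 <= #|nbrs S w|)%N ->
  (forall u, u \in S ->
    move_cost S u <= 2 + 3 * #|nbrs S w|%:Z + 5 * #|leaves S w|%:Z) ->
  (forall u, u \in nbrs S w -> move_cost S u <= 13) ->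
  good_move S v.
Proof.
move=> vS Nv dw le_all le_adj.
have wv : w \in nbrs S v by rewrite Nv in_set1.
have vl : v \in leaves S w.
  by apply/leavesP; rewrite Nv cards1; split=> //; apply: nbrs_sym wv.
have lw : #|leaves S w| = #|leaves S w :\ v|.+1 by rewrite (cardsD1 v) vl.
have cv := move_cost_leaf Nv; rewrite /nbr_cost in cv.
split=> [|u uR]; first by lia.
have uS : u \in S by move: uR; rewrite in_remainder => /andP[].
have wS : w \in S by move: wv; rewrite in_nbrs => /andP[].
have lu := le_all u uS.
case: (response_cost vS uR) => [|||].
- by lia.
- by lia.
- by case=> b _ [_]; lia.
case=> b; rewrite Nv in_set1 => /eqP-> [wu].
have uw : u \in nbrs S w by rewrite in_nbrs uS.
have := le_adj u uw; rewrite /nbr_cost.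
by have := subset_leq_card (subsetDl (leaves S w) [set u]); lia.
Qed.

(** With d and l as the degree and leaf count of [w], the reply may cost at least 8 + 3d + 5l; after
    a rise by 3, [le_all] fits because d + 2l is at least 3. For replies adjacent to [y], the terms
    of [y] cancel. *)
Lemma good_path S w x y : x \in S -> nbrs S x = [set w; y] -> w != y ->
  (2 <= #|nbrs S w|)%N -> (2 <= #|nbrs S y|)%N ->
  (3 <= #|nbrs S w| + 2 * #|leaves S w|)%N ->
  (forall u, u \in S ->
     move_cost S u <= 8 + 2 * #|nbrs S w|%:Z + 3 * #|leaves S w|%:Z) ->
  (forall u, u \in nbrs S w -> move_cost S u <= 13) ->
  good_move S x.
Proof.
move=> xS Nx wy dw dy dlw le_all le_adj.
have dx : (2 <= #|nbrs S x|)%N by rewrite Nx cards2 wy.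
have cx : move_cost S x = 24 - 3 * #|nbrs S w|%:Z - 5 * #|leaves S w|%:Z
                            - 3 * #|nbrs S y|%:Z - 5 * #|leaves S y|%:Z.
  have wx : w \in nbrs S x by rewrite Nx in_set2 eqxx.
  rewrite (move_costE wx) Nx big_setU1 ?in_set1 //= big_set1 !nbr_cost_back //.
  by lia.
split=> [|u uR]; first by lia.
have uS : u \in S by move: uR; rewrite in_remainder => /andP[].
have lu := le_all u uS.
case: (response_cost xS uR) => [|||].
- by lia.
- by lia.
- by case=> b _ [_]; lia.
case=> b; rewrite Nx in_set2 /nbr_cost => /orP[]/eqP-> [bu].
  have uw : u \in nbrs S w by rewrite in_nbrs uS.
  have := le_adj u uw.
  by have := subset_leq_card (subsetDl (leaves S w) [set u]); lia.
by have := subset_leq_card (subsetDl (leaves S y) [set u]); lia.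
Qed.

(** An isolated vertex or an end of an isolated edge raises no reply above 13. For any other leaf,
    [good_leaf] applies, since 2 + 3d + 5l is at least 13. *)
Lemma good_move_low S : S != set0 -> (forall u, u \in S -> move_cost S u <= 13) ->
  exists2 s, s \in S & good_move S s.
Proof.
move=> S0 le13; have [v vS dv] := small_degree S0.
exists v => //.
have [dv0|] := posnP #|nbrs S v|.
  split=> [|u uR]; first exact: le13.
  have uS : u \in S by move: uR; rewrite in_remainder => /andP[].
  have Nv : nbrs S v = set0 by apply/eqP; rewrite -cards_eq0 dv0.
  have := le13 u uS; have := le13 v vS.
  case: (response_cost vS uR) => [|||]; [lia | lia | |];
    by case=> b; rewrite Nv in_set0.
move=> dv1; have /cards1P[w Nv] : #|nbrs S v| == 1%N by rewrite eqn_leq dv.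
have wv : w \in nbrs S v by rewrite Nv in_set1.
have wS : w \in S by move: wv; rewrite in_nbrs => /andP[].
have vw := nbrs_sym vS wv.
have vl : v \in leaves S w by apply/leavesP; rewrite Nv cards1.
have lw : (0 < #|leaves S w|)%N by apply/card_gt0P; exists v.
have [dw|dw] := leqP 2 #|nbrs S w|.
  apply: (good_leaf vS Nv dw) => u; last first.
    by rewrite in_nbrs => /andP[uS _]; apply: le13.
  by move=> uS; have := le13 u uS; lia.
split=> [|u uR]; first exact: le13.
have uS : u \in S by move: uR; rewrite in_remainder => /andP[].
have := le13 u uS; have := le13 v vS.
case: (response_cost vS uR) => [|||]; [lia | lia | |].
  by case=> b; rewrite Nv in_set1 => /eqP-> []; lia.
case=> b; rewrite Nv in_set1 => /eqP-> [wu _].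
have : (1 < #|nbrs S w|)%N.
  apply/card_gt1P; exists u, v; split=> //; first by rewrite in_nbrs uS.
  by move: uR; rewrite in_remainder => /and3P[].
by lia.
Qed.

Lemma exists_good_move S : S != set0 -> exists2 s, s \in S & good_move S s.
Proof.
move=> S0; have /set0Pn[v0 v0S] := S0.
have [w wS wmax] : exists2 w, w \in S & forall u, u \in S -> move_cost S u <= move_cost S w.
  by case: (Order.TotalTheory.arg_maxP (move_cost S) v0S) => w wS wmax; exists w.
have [low|high] := lerP (move_cost S w) 13.
  by apply: good_move_low => // u /wmax /le_trans; apply.
(* An isolated vertex costs 13 and a leaf at most 8 + 5. *)
have dw : (2 <= #|nbrs S w|)%N.
  rewrite leqNgt; apply/negP=> dw; move: high.
  have [/eqP|dw0] := posnP #|nbrs S w|.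
    by rewrite cards_eq0 /move_cost => ->.
  have /cards1P[v Nw] : #|nbrs S w| == 1%N by rewrite eqn_leq dw0 -ltnS dw.
  have vw : v \in nbrs S w by rewrite Nw in_set1.
  have := nbrs_gt0 wS vw; rewrite (move_cost_leaf Nw) /nbr_cost; lia.
have le_adj u : u \in nbrs S w -> move_cost S u <= 13.
  move=> uw; apply: (move_cost_adj_le wS uw dw); apply: wmax.
  by move: uw; rewrite in_nbrs => /andP[].
have le_w := move_cost_le wS dw.
have [/existsP[x /and3P[xw /eqP dx /eqP lx]]|/existsPn rigid] := boolP
    [exists x, [&& x \in nbrs S w, #|nbrs S x| == 2 & leaves S x :\ w == set0]].
  have xS : x \in S by move: xw; rewrite in_nbrs => /andP[].
  have wx := nbrs_sym wS xw.
  have /cards1P[y Ny] : #|nbrs S x :\ w| == 1%N.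
    by move: dx; rewrite (cardsD1 w) wx add1n => -[->].
  have Nx : nbrs S x = [set w; y] by rewrite -(setD1K wx) Ny.
  have /andP[yw yx] : (y != w) && (y \in nbrs S x).
    by rewrite -in_setD1 Ny in_set1.
  have dy : (2 <= #|nbrs S y|)%N.
    have := nbrs_gt0 xS yx; rewrite leq_eqVlt => /orP[/eqP dy|//].
    have : y \in leaves S x :\ w by rewrite in_setD1 yw; apply/leavesP.
    by rewrite lx in_set0.
  exists x => //; apply: (good_path xS Nx) => //; first by rewrite eq_sym.
    by lia.
  by move=> u uS; have := wmax u uS; lia.
have le_r : move_cost S w <= 8 - #|nbrs S w|%:Z + 6 * #|leaves S w|%:Z.
  apply: move_cost_le_rigid => // x xw dx; have := rigid x.
  by rewrite xw dx eqxx.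
(* Without leaves, [le_r] would contradict [high]. *)
have /card_gt0P[v /leavesP[vw dv]] : (0 < #|leaves S w|)%N by lia.
have vS : v \in S by move: vw; rewrite in_nbrs => /andP[].
have Nv : nbrs S v = [set w].
  have /cards1P[w' Nv] : #|nbrs S v| == 1%N by rewrite dv.
  by have := nbrs_sym wS vw; rewrite Nv in_set1 => /eqP->.
exists v => //; apply: (good_leaf vS Nv dw) => // u uS.
(* With l at most d and d at least 2, 8 - d + 6l is at most 2 + 3d + 5l. *)
have := subset_leq_card (_ : leaves S w \subset nbrs S w).
by have := wmax u uS; lia.
Qed.

(** * From good moves to the value of the game *)

Lemma legal_remainder A v : v \in legal_moves A ->
  legal_moves (v |: A) = remainder (legal_moves A) v.
Proof.
move=> vA; apply/setP=> u; rewrite in_remainder !inE negb_or.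
case: (u \in A); rewrite ?andbF //= andbT.
apply/andP/and3P => [[uv /forallP avoid]|[/forallP avoid uv nvu]].
  split=> //; last by have := avoid v; rewrite setU11.
  by apply/forallP=> z; apply/implyP=> zA; have := avoid z; rewrite inE zA orbT.
split=> //; apply/forallP=> z; apply/implyP.
by rewrite !inE => /orP[/eqP->//|zA]; have := avoid z; rewrite zA.
Qed.

Lemma final_size_Sweller_ge A v : v \in legal_moves A ->
  (final_size Diminisher (v |: A) <= final_size Sweller A)%N.
Proof.
move=> vA; rewrite [final_size Sweller A]final_sizeE.
have /negPf-> : legal_moves A != set0 by apply/set0Pn; exists v.
exact: (@leq_bigmax_cond _ (fun u => u \in legal_moves A)
  (fun u => final_size Diminisher (u |: A)) v vA).
Qed.

(** Induction over rounds: a good move and any reply add 2 vertices and cost the potential, which is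
    doubled, at most 52. *)
Lemma final_size_ge_potential A :
  26 * #|A|%:Z + potential (legal_moves A) <= 26 * (final_size Sweller A)%:Z.
Proof.
move: {2}#|legal_moves A| (leqnn #|legal_moves A|) => k.
elim: k A => [|k IHk] A le_k.
  have L0 : legal_moves A = set0 by apply/eqP; rewrite -cards_eq0 -leqn0.
  by rewrite final_sizeE L0 eqxx /potential big_set0; lia.
have [L0|L0] := eqVneq (legal_moves A) set0.
  by rewrite final_sizeE L0 eqxx /potential big_set0; lia.
have [s sL [s13 s26]] := exists_good_move L0.
have := final_size_Sweller_ge sL.
have cardU v B : v \in legal_moves B -> #|v |: B| = #|B|.+1.
  by rewrite inE cardsU1 => /andP[-> _].
have cardR v B : v \in legal_moves B ->
    (#|legal_moves (v |: B)| < #|legal_moves B|)%N.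
  move=> vB; rewrite legal_remainder //; apply: proper_card.
  apply/properP; split; first exact: subsetDl.
  by exists v => //; rewrite in_remainder eqxx andbF.
have pot_s := potential_remainder sL.
rewrite [final_size Diminisher _]final_sizeE; case: eqP => [E|/eqP L1].
  move: pot_s; rewrite -legal_remainder // E /potential big_set0 cardU //.
  by lia.
have [|v vL ->] := best_attained Diminisher
  (F := fun v => final_size Sweller (v |: (s |: A))) L1.
  by move=> v; apply: final_size_le.
have := IHk (v |: (s |: A)); rewrite cardU // cardU //.
have := cardR _ _ vL; have := cardR _ _ sL => lt1 lt2.
have le_k2 : (#|legal_moves (v |: (s |: A))| <= k)%N by lia.
move=> /(_ le_k2).
have := potential_remainder vL; rewrite -(legal_remainder vL).
rewrite -(legal_remainder sL) in pot_s s26; have := s26 _ vL.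
by lia.
Qed.

(** Dropping the bonus of isolated vertices leaves 16m - 3(2m - 2) = 10m + 6 for m vertices. *)
Lemma potential_ge S : S != set0 -> 10 * #|S|%:Z + 6 <= potential S.
Proof.
move=> /sum_degree dS.
have le_w : \sum_(v in S) (16 - 3 * #|nbrs S v|%:Z) <= potential S.
  by apply: ler_sum => v _; rewrite /weight lerDl; case: ifP.
apply: le_trans le_w.
rewrite big_split /= sumr_const sumrN -mulr_sumr -(big_morph Posz PoszD (erefl 0%:Z)).
by lia.
Qed.

End Forest.

Theorem theorem2 (T : sgraph) (n : nat) (hT : is_tree T) (hn : #|T| = n) :
  (5 * n%:R + 3) / 13 <= (I_s T)%:R :> rat.
Proof.
case: hT => -[T0 _] acyclicT.
have := final_size_ge_potential acyclicT set0.
have -> : legal_moves (set0 : {set T}) = [set: T].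
  apply/setP=> u; rewrite !inE; apply/forallP=> v; by rewrite inE.
have := @potential_ge T acyclicT [set: T]; rewrite -card_gt0 cardsT => /(_ T0).
rewrite cards0 hn -/(I_s T) => le1 le2.
have le_n : (5 * n + 3 <= I_s T * 13)%N by lia.
by rewrite ler_pdivrMr // -!natrM -natrD ler_nat.
Qed.
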